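(* Let $m\ge 0$, $q\ge 1$ be integers with $m+q\ge 2$, and let $(m,q)$ denote the greatest common divisor of $m$ and $q$. Let $p,n\geq 3$ be integers such that $p\equiv n \pmod{2q/(m,q)}$. Then, for any left $\mathbb{D}C_{m,q}$-module $\mathcal{A}$ and any right $\mathbb{D}C_{m,q}$-module $\mathcal{B}$, there are isomorphisms $$\mathrm{H}^{p}(C_{m,q},\mathcal{A})\cong \mathrm{H}^{n}(C_{m,q},\mathcal{A}),\qquad \mathrm{H}_{p}(C_{m,q},\mathcal{B})\cong \mathrm{H}_{n}(C_{m,q},\mathcal{B}).$$ If $m=1$, then there are also isomorphisms $$\mathrm{H}^{n}(C_{1,q},\mathcal{A})\cong \mathrm{H}^{2}(C_{1,q},\mathcal{A}),\qquad \mathrm{H}_{n}(C_{1,q},\mathcal{B})\cong \mathrm{H}_{2}(C_{1,q},\mathcal{B}),$$ for any integer $n\geq 2$ such that $n\equiv 2\pmod{2q}$ (and any left, respectively right, $\mathbb{D}C_{1,q}$-module $\mathcal{A}$, respectively $\mathcal{B}$).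
   Context: **Cyclic monoids.** $\mathbb{N}=\{0,1,\dots\}$. For $m\ge 0$, $q\ge 1$, the cyclic monoid $C_{m,q}$ of index $m$ and period $q$ is the set $\{0,1,\dots,m+q-1\}$ with addition $x\oplus y=\wp(x+y)$, where $\wp:\mathbb{N}\to C_{m,q}$ is given by $\wp(x)=x$ if $x<m+q$ and, for $x\ge m$, $\wp(x)$ is the unique element of $\{m,\dots,m+q-1\}$ congruent to $x$ modulo $q$. It is assumed that $m+q\ge 2$. **The category $\mathbb{D}M$ and its modules.** For a monoid $M$ (written additively), $\mathbb{D}M$ is the category with object set $M$ and arrow set $M\times M\times M$, where $(x,y,z):y\to x+y+z$; composition is $(u,x+y+z,v)(x,y,z)=(u+x,y,z+v)$ and the identity of $x$ is $(0,x,0)$. A left (resp. right) $\mathbb{D}M$-module is a functor $\mathbb{D}M\to\mathbf{Ab}$ (resp. $\mathbb{D}M^{op}\to\mathbf{Ab}$); morphisms are natural transformations. **Leech (co)homology.** For a left $\mathbb{D}M$-module $\mathcal{A}$, $\mathrm{H}^n(M,\mathcal{A})=\mathrm{Ext}^n_{\mathbb{D}M}(\mathbb{Z},\mathcal{A})$ in the abelian category of left $\mathbb{D}M$-modules, where $\mathbb{Z}$ is the constant functor with value $\mathbb{Z}$. For a right $\mathbb{D}M$-module $\mathcal{B}$, $\mathrm{H}_n(M,\mathcal{B})=\mathrm{Tor}_n^{\mathbb{D}M}(\mathcal{B},\mathbb{Z})$, the $n$-th left derived functor of $\mathcal{B}\otimes_{\mathbb{D}M}-$ evaluated at $\mathbb{Z}$,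 where $\mathcal{B}\otimes_{\mathbb{D}M}\mathcal{A}$ is the coend in $\mathbf{Ab}$ of $(x,y)\mapsto\mathcal{B}(x)\otimes\mathcal{A}(y)$. *)

(* Defs.v *)
From HB Require Import structures.
From mathcomp Require Import all_boot all_order all_algebra.
From mathcomp Require Import boolp.
From mathcomp Require Import freeg.

Set Implicit Arguments.
Unset Strict Implicit.
Unset Printing Implicit Defensive.

Import GRing.Theory.

Local Open Scope ring_scope.

Definition zmod_iso (U V : zmodType) : Prop :=
  exists f : {additive U -> V}, bijective f.

Section Homology.
Variables (U V W : zmodType) (f : {additive U -> V}) (g : {additive V -> W}).

Definition cycle_pred : {pred V} := [pred v | g v == 0].

Lemma cycle_zmod_closed : zmod_closed cycle_pred.
Proof.
split=> [|u v]; rewrite !inE ?raddf0 // => /eqP gu /eqP gv.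
by rewrite raddfB gu gv subrr.
Qed.
HB.instance Definition _ :=
  GRing.isZmodClosed.Build V cycle_pred cycle_zmod_closed.

Record cycle := Cycle { cycle_val : V; _ : cycle_val \in cycle_pred }.
HB.instance Definition _ := [isSub for cycle_val].
HB.instance Definition _ := [Choice of cycle by <:].
HB.instance Definition _ := [SubChoice_isSubZmodule of cycle by <:].

Definition boundary : {pred cycle} :=
  [pred z | `[< exists u, f u = cycle_val z >]].

Lemma boundary_zmod_closed : zmod_closed boundary.
Proof.
split=> [|z1 z2]; rewrite !inE.
  by apply/asboolP; exists 0; rewrite raddf0.
move=> /asboolP[u1 f1] /asboolP[u2 f2]; apply/asboolP.
by exists (u1 - u2); rewrite raddfB f1 f2.
Qed.
HB.instance Definition _ :=
  GRing.isZmodClosed.Build cycle boundary boundary_zmod_closed.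

(* [ker g / im f]; it is only used when [g \o f = 0]. *)
Definition homology : zmodType := Quotient.quot boundary.

End Homology.

Record category := Category {
  obj : Type;
  hom : obj -> obj -> Type;
  idm : forall x, hom x x;
  comp : forall x y z, hom y z -> hom x y -> hom x z;
  comp_idl : forall x y (f : hom x y), comp (idm y) f = f;
  comp_idr : forall x y (f : hom x y), comp f (idm x) = f;
  comp_assoc : forall w x y z (h : hom y z) (g : hom x y) (f : hom w x),
    comp h (comp g f) = comp (comp h g) f
}.
Arguments idm {c} x.
Arguments comp {c x y z} _ _.

Definition op (C : category) : category :=
  @Category (obj C) (fun x y => @hom C y x) (fun x => idm x)
    (fun x y z g f => comp f g)
    (fun x y f => comp_idr f) (fun x y f => comp_idl f)
    (fun w x y z h g f => esym (comp_assoc f g h)).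

(* A (left) module over [C] is a functor from [C] to abelian groups; a right
   module is a module over [op C]. *)
Record module (C : category) := Module {
  mobj :> obj C -> zmodType;
  mact : forall x y, hom x y -> {additive mobj x -> mobj y};
  mact_id : forall x (a : mobj x), mact (idm x) a = a;
  mact_comp : forall x y z (g : hom y z) (f : hom x y) (a : mobj x),
    mact (comp g f) a = mact g (mact f a)
}.
Arguments mact {C} m {x y} f.

Record module_hom (C : category) (A B : module C) := ModuleHom {
  mh :> forall x, A x -> B x;
  mh_additive : forall x, zmod_morphism (@mh x);
  mh_natural : forall x y (f : hom x y) (a : A x),
    mh (mact A f a) = mact B f (mh a)
}.
Arguments mh {C A B} _ {x} _.

HB.instance Definition _ C (A B : module C) (phi : module_hom A B) x :=
  GRing.isZmodMorphism.Build (A x) (B x) (@mh C A B phi x)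
    (mh_additive phi (x := x)).

Section ModuleHomGroup.
Variables (C : category) (A B : module C).
Implicit Types phi psi : module_hom A B.

Lemma module_homP phi psi : (forall x (a : A x), mh phi a = mh psi a) ->
  phi = psi.
Proof.
case: phi psi => [f fa fn] [g ga gn] /= e.
have fg : f = g by apply: functional_extensionality_dep => x; apply/funext.
by subst g; congr ModuleHom; apply: Prop_irrelevance.
Qed.

HB.instance Definition _ := gen_eqMixin (module_hom A B).
HB.instance Definition _ := gen_choiceMixin (module_hom A B).

Program Definition mh_zero : module_hom A B :=
  @ModuleHom C A B (fun x _ => 0) _ _.
Next Obligation. by move=> a b; rewrite subrr. Qed.
Next Obligation. by rewrite raddf0. Qed.

Program Definition mh_opp phi : module_hom A B :=
  @ModuleHom C A B (fun x a => - mh phi a) _ _.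
Next Obligation. by move=> a b; rewrite raddfB opprB opprK addrC. Qed.
Next Obligation. by rewrite mh_natural raddfN. Qed.

Program Definition mh_add phi psi : module_hom A B :=
  @ModuleHom C A B (fun x a => mh phi a + mh psi a) _ _.
Next Obligation. by move=> a b; rewrite !raddfB opprD addrACA. Qed.
Next Obligation. by rewrite !mh_natural raddfD. Qed.

Lemma mh_addA : associative mh_add.
Proof. by move=> f g h; apply: module_homP => x a; rewrite /= addrA. Qed.
Lemma mh_addC : commutative mh_add.
Proof. by move=> f g; apply: module_homP => x a; rewrite /= addrC. Qed.
Lemma mh_add0 : left_id mh_zero mh_add.
Proof. by move=> f; apply: module_homP => x a; rewrite /= add0r. Qed.
Lemma mh_addN : left_inverse mh_zero mh_opp mh_add.
Proof. by move=> f; apply: module_homP => x a; rewrite /= addNr. Qed.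

HB.instance Definition _ := GRing.isZmodule.Build (module_hom A B)
  mh_addA mh_addC mh_add0 mh_addN.

End ModuleHomGroup.

Program Definition mh_comp C (A B D : module C) (psi : module_hom B D)
    (phi : module_hom A B) : module_hom A D :=
  @ModuleHom C A D (fun x a => mh psi (mh phi a)) _ _.
Next Obligation. by move=> a b; rewrite !raddfB. Qed.
Next Obligation. by rewrite !mh_natural. Qed.

Section Precomposition.
Variables (C : category) (A B D : module C) (phi : module_hom A B).

Definition precomp (psi : module_hom B D) : module_hom A D := mh_comp psi phi.

Lemma precomp_zmod_morphism : zmod_morphism precomp.
Proof. by move=> f g; apply: module_homP. Qed.
HB.instance Definition _ := GRing.isZmodMorphism.Build _ _ precomp
  precomp_zmod_morphism.

End Precomposition.
Arguments precomp {C A B} D phi psi.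

Section FreeLift.
Variables (K : choiceType) (V : zmodType) (f : K -> V).

Definition free_lift (t : {freeg K / int}) : V :=
  fglift (f : K -> zmodule V) t.

Lemma free_lift_zmod_morphism : zmod_morphism free_lift.
Proof. exact: (@lift_is_additive _ _ (zmodule V)). Qed.
HB.instance Definition _ := GRing.isZmodMorphism.Build _ _ free_lift
  free_lift_zmod_morphism.

Lemma free_liftU k : free_lift << k >> = f k.
Proof. by rewrite /free_lift liftU scale1r. Qed.

Lemma free_lift_unique (g : {additive {freeg K / int} -> V}) :
  (forall k, g << k >> = f k) -> g =1 free_lift.
Proof.
move=> gf t; rewrite -[t]freeg_sumE !raddf_sum; apply: eq_bigr => k _.
have -> : << coeff k t *g k >> = << k >> *~ coeff k t :> {freeg K / int}.
  by rewrite freegU_mulz intz.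
by rewrite !raddfMz gf; congr (_ *~ _); rewrite -[LHS]free_liftU.
Qed.

End FreeLift.

(* Kernels, images and epimorphisms of modules are computed objectwise. *)
Definition mh_surj C (A B : module C) (phi : module_hom A B) : Prop :=
  forall x (b : B x), exists a, mh phi a = b.

Definition mh_exact C (A B D : module C) (phi : module_hom A B)
    (psi : module_hom B D) : Prop :=
  forall x (b : B x), mh psi b = 0 <-> exists a, mh phi a = b.

Definition projective C (P : module C) : Prop :=
  forall (A B : module C) (g : module_hom A B) (f : module_hom P B),
    mh_surj g -> exists h : module_hom P A, mh_comp g h = f.

Record resolution C (X : module C) := Resolution {
  res : nat -> module C;
  res_d : forall n, module_hom (res n.+1) (res n);
  res_aug : module_hom (res 0) X;
  res_projective : forall n, projective (res n);
  res_aug_surj : mh_surj res_aug;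
  res_exact0 : mh_exact (res_d 0) res_aug;
  res_exact : forall n, mh_exact (res_d n.+1) (res_d n)
}.

Section FreeModule.
Variables (C : category) (X : module C).

Definition free_key (y : obj C) := {classic {x : obj C & X x * hom x y}%type}.
Definition free_key_of x y (a : X x) (f : hom x y) : free_key y :=
  existT (fun x => X x * hom x y)%type x (a, f).

Definition free_obj (y : obj C) : zmodType := {freeg (free_key y) / int}.
Definition free_gen x y (a : X x) (f : hom x y) : free_obj y :=
  << free_key_of a f >>.

Definition free_act y z (g : hom y z) : free_obj y -> free_obj z :=
  free_lift (fun k : free_key y =>
    free_gen (projT2 k).1 (comp g (projT2 k).2)).
HB.instance Definition _ y z (g : hom y z) :=
  GRing.Additive.copy (free_act g) (free_act g).

Lemma free_actE x y z (g : hom y z) (a : X x) (f : hom x y) :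
  free_act g (free_gen a f) = free_gen a (comp g f).
Proof. exact: free_liftU. Qed.

Lemma free_eq y (V : zmodType) (g h : {additive free_obj y -> V}) :
  (forall x (a : X x) (f : hom x y), g (free_gen a f) = h (free_gen a f)) ->
  g =1 h.
Proof.
move=> gh t; rewrite (@free_lift_unique _ _ (fun k => h << k >>) g).
  by rewrite -(@free_lift_unique _ _ (fun k => h << k >>) h).
by case=> x [a f]; apply: gh.
Qed.

Program Definition free_module : module C :=
  @Module C free_obj (fun y z g => free_act g) _ _.
Next Obligation.
apply: (free_eq (g := free_act (idm x)) (h := idfun)) => w b f /=.
by rewrite free_actE comp_idl.
Qed.
Next Obligation.
apply: (free_eq (g := free_act (comp g f)) (h := free_act g \o free_act f)).
by move=> w b h /=; rewrite !free_actE comp_assoc.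
Qed.

Definition free_ext_fun (B : module C) (u : forall x, X x -> B x) y :
    free_module y -> B y :=
  free_lift (fun k : free_key y => mact B (projT2 k).2 (u _ (projT2 k).1)).
HB.instance Definition _ B u y :=
  GRing.Additive.copy (@free_ext_fun B u y) (@free_ext_fun B u y).

Lemma free_ext_funE B u x y (a : X x) (f : hom x y) :
  @free_ext_fun B u y (free_gen a f) = mact B f (u x a).
Proof. exact: free_liftU. Qed.

(* Every (merely set-theoretic) family of maps [X x -> B x] extends to a
   morphism [free_module -> B]. *)
Program Definition free_ext B u : module_hom free_module B :=
  @ModuleHom C free_module B (@free_ext_fun B u) _ _.
Next Obligation. by move=> s t; apply: raddfB. Qed.
Next Obligation.
apply: (free_eq (g := @free_ext_fun B u y \o free_act f)
                (h := mact B f \o @free_ext_fun B u x)) => w b g /=.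
by rewrite free_actE !free_ext_funE mact_comp.
Qed.

Definition free_counit : module_hom free_module X := free_ext (fun x a => a).

Lemma free_counit_surj : mh_surj free_counit.
Proof.
by move=> x a; exists (free_gen a (idm x)); rewrite [LHS]free_ext_funE mact_id.
Qed.

Lemma free_projective : projective free_module.
Proof.
move=> A B g f gS.
pose u x (a : X x) := sval (cid (gS x (mh f (free_gen a (idm x))))).
have uE x a : mh g (u x a) = mh f (free_gen a (idm x)).
  by rewrite /u; case: cid.
exists (free_ext u); apply: module_homP => y.
apply: (@free_eq y (B y) (@mh _ _ _ g y \o @free_ext_fun A u y)
  (@mh _ _ _ f y : {additive free_module y -> B y})) => x a h /=.
rewrite free_ext_funE (mh_natural g h (u x a)) uE -(mh_natural f h) /=.
by rewrite free_actE comp_idr.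
Qed.

End FreeModule.

Section KernelModule.
Variables (C : category) (A B : module C) (phi : module_hom A B).

Definition ker_obj x : zmodType := cycle (@mh _ _ _ phi x).

Lemma ker_act_subproof x y (f : hom x y) (a : ker_obj x) :
  mact A f (cycle_val a) \in cycle_pred (@mh _ _ _ phi y).
Proof.
case: a => a /=; rewrite !inE /= => /eqP a0.
by rewrite (mh_natural phi f a) a0 raddf0.
Qed.

Definition ker_act x y (f : hom x y) (a : ker_obj x) : ker_obj y :=
  Cycle (ker_act_subproof f a).

Lemma ker_act_zmod_morphism x y (f : hom x y) : zmod_morphism (ker_act f).
Proof. by move=> a b; apply: val_inj; rewrite /= raddfB. Qed.
HB.instance Definition _ x y (f : hom x y) :=
  GRing.isZmodMorphism.Build (ker_obj x) (ker_obj y) (ker_act f)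
    (ker_act_zmod_morphism f).

Program Definition ker_module : module C :=
  @Module C ker_obj (fun x y f => ker_act f) _ _.
Next Obligation. by apply: val_inj; rewrite /= mact_id. Qed.
Next Obligation. by apply: val_inj; rewrite /= mact_comp. Qed.

Program Definition ker_incl : module_hom ker_module A :=
  @ModuleHom C ker_module A (fun x a => cycle_val a) _ _.
Next Obligation. by []. Qed.

End KernelModule.

Section FreeResolution.
Variables (C : category) (X : module C).

Fixpoint syzygy n : module C :=
  if n is k.+1 then ker_module (free_counit (syzygy k)) else X.

Definition free_d n :
    module_hom (free_module (syzygy n.+1)) (free_module (syzygy n)) :=
  mh_comp (ker_incl (free_counit (syzygy n))) (free_counit (syzygy n.+1)).

Lemma free_exact n : mh_exact (free_d n) (free_counit (syzygy n)).
Proof.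
move=> x b; split=> [b0 | [a <-]].
  have bP : b \in cycle_pred (@mh _ _ _ (free_counit (syzygy n)) x).
    by rewrite inE; apply/eqP.
  have [a aE] := free_counit_surj (X := syzygy n.+1) (Cycle bP).
  by exists a; apply: (congr1 val aE).
have := valP (mh (free_counit (syzygy n.+1)) a).
by rewrite inE => /eqP.
Qed.

Lemma free_exactS n : mh_exact (free_d n.+1) (free_d n).
Proof.
move=> x b; split=> [b0 | /(free_exact (n := n.+1) b) b0].
  by apply/(free_exact (n := n.+1) b); apply: val_inj.
exact: (congr1 val b0).
Qed.

Definition free_resolution : resolution X :=
  @Resolution C X (fun n => free_module (syzygy n)) free_d (free_counit X)
    (fun n => free_projective (X := syzygy n)) (free_counit_surj (X := X))
    (free_exact (n := 0)) free_exactS.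

End FreeResolution.

(* Cohomology of Hom(P, A); the complex is zero in negative degrees. *)
Definition Ext_of C (X : module C) (P : resolution X) n (A : module C) :
    zmodType :=
  if n is k.+1 then homology (precomp A (res_d P k)) (precomp A (res_d P k.+1))
  else homology (\0 : {additive module_hom (res P 0) A -> _})
         (precomp A (res_d P 0)).

Definition Ext C n (X A : module C) : zmodType :=
  Ext_of (free_resolution X) n A.

Section Tensor.
Variables (C : category) (B : module (op C)) (A : module C).

Definition tensor_key := {classic {x : obj C & B x * A x}%type}.
Definition tensor_key_of x (b : B x) (a : A x) : tensor_key :=
  existT (fun x => B x * A x)%type x (b, a).
Definition free_tensor : zmodType := {freeg tensor_key / int}.
Definition pre_tensor x (b : B x) (a : A x) : free_tensor :=
  << tensor_key_of b a >>.

(* The subgroup generated by biadditivity of each [B x * A x -> _] (which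
   yields the direct sum of the [B x (x) A x]) and by dinaturality (which
   yields the coend). *)
Inductive tensor_rel : free_tensor -> Prop :=
| TensorRel0 : tensor_rel 0
| TensorRelB s t : tensor_rel s -> tensor_rel t -> tensor_rel (s - t)
| TensorRelDl x (b1 b2 : B x) (a : A x) : tensor_rel
    (pre_tensor (b1 + b2) a - (pre_tensor b1 a + pre_tensor b2 a))
| TensorRelDr x (b : B x) (a1 a2 : A x) : tensor_rel
    (pre_tensor b (a1 + a2) - (pre_tensor b a1 + pre_tensor b a2))
| TensorRelAct x y (f : @hom C x y) (b : B y) (a : A x) : tensor_rel
    (pre_tensor (@mact _ B y x f b) a - pre_tensor b (mact A f a)).

Definition tensor_rel_pred : {pred free_tensor} :=
  [pred t | `[< tensor_rel t >]].

Lemma tensor_rel_zmod_closed : zmod_closed tensor_rel_pred.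
Proof.
split=> [|s t]; rewrite !inE; first by apply/asboolP; constructor.
by move=> /asboolP s0 /asboolP t0; apply/asboolP; constructor.
Qed.
HB.instance Definition _ := GRing.isZmodClosed.Build free_tensor
  tensor_rel_pred tensor_rel_zmod_closed.

Definition tensor : zmodType := Quotient.quot tensor_rel_pred.

(* [tensor], with the universal balanced family [tensor_mk], is the coend of
   (x, y) |-> B x (x) A y: see [tensor_liftE] and [tensor_eq]. *)
Definition tensor_mk x (b : B x) (a : A x) : tensor :=
  \pi_tensor%qT (pre_tensor b a).

Definition balanced (V : zmodType) (u : forall x, B x -> A x -> V) : Prop :=
  [/\ forall x (b1 b2 : B x) (a : A x), u x (b1 + b2) a = u x b1 a + u x b2 a,
      forall x (b : B x) (a1 a2 : A x), u x b (a1 + a2) = u x b a1 + u x b a2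
    & forall x y (f : @hom C x y) (b : B y) (a : A x),
        u x (@mact _ B y x f b) a = u y b (mact A f a)].

Lemma tensor_mk_balanced : balanced tensor_mk.
Proof.
split=> *; rewrite /tensor_mk -?raddfD; apply/eqP;
  by rewrite -Quotient.idealrBE inE; apply/asboolP; constructor.
Qed.

Section TensorLift.
Variables (V : zmodType) (u : forall x, B x -> A x -> V) (bal_u : balanced u).

Definition pre_tensor_lift : free_tensor -> V :=
  free_lift (fun k : tensor_key => u (projT2 k).1 (projT2 k).2).
HB.instance Definition _ :=
  GRing.Additive.copy pre_tensor_lift pre_tensor_lift.

Lemma pre_tensor_liftE x (b : B x) (a : A x) :
  pre_tensor_lift (pre_tensor b a) = u b a.
Proof. exact: free_liftU. Qed.

Lemma pre_tensor_lift_rel t : tensor_rel t -> pre_tensor_lift t = 0.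
Proof.
have [uDl uDr uact] := bal_u.
elim=> [|s r _ s0 _ r0|x b1 b2 a|x b a1 a2|x y f b a]; first exact: raddf0.
- by rewrite raddfB /= s0 r0 subrr.
- by rewrite raddfB raddfD /= !pre_tensor_liftE uDl subrr.
- by rewrite raddfB raddfD /= !pre_tensor_liftE uDr subrr.
- by rewrite raddfB /= !pre_tensor_liftE uact subrr.
Qed.

Definition tensor_lift of balanced u := fun t : tensor =>
  pre_tensor_lift (repr t).

Lemma tensor_lift_pi t : tensor_lift bal_u (\pi_tensor%qT t) = pre_tensor_lift t.
Proof.
apply/eqP; rewrite -subr_eq0 -raddfB; apply/eqP/pre_tensor_lift_rel.
have : repr (\pi_tensor%qT t) - t \in tensor_rel_pred.
  by rewrite Quotient.idealrBE reprK.
by rewrite inE => /asboolP.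
Qed.

Lemma tensor_liftE x (b : B x) (a : A x) :
  tensor_lift bal_u (tensor_mk b a) = u b a.
Proof. by rewrite tensor_lift_pi pre_tensor_liftE. Qed.

Lemma tensor_lift_zmod_morphism : zmod_morphism (tensor_lift bal_u).
Proof.
move=> s t; rewrite -[s]reprK -[t]reprK -raddfB /=.
by rewrite !tensor_lift_pi raddfB.
Qed.
HB.instance Definition _ := GRing.isZmodMorphism.Build _ _
  (tensor_lift bal_u) tensor_lift_zmod_morphism.

End TensorLift.

Lemma tensor_eq (V : zmodType) (g h : {additive tensor -> V}) :
  (forall x (b : B x) (a : A x), g (tensor_mk b a) = h (tensor_mk b a)) ->
  g =1 h.
Proof.
move=> gh t; rewrite -[t]reprK.
pose g' : {additive free_tensor -> V} := g \o \pi_tensor%qT.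
pose h' : {additive free_tensor -> V} := h \o \pi_tensor%qT.
rewrite -[LHS]/(g' (repr t)) -[RHS]/(h' (repr t)).
rewrite (@free_lift_unique _ _ (fun k => h' << k >>) g').
  by rewrite -(@free_lift_unique _ _ (fun k => h' << k >>) h').
by case=> x [b a]; apply: gh.
Qed.

End Tensor.
Arguments tensor_mk {C B A x} b a.

Section TensorMap.
Variables (C : category) (B : module (op C)) (A D : module C).
Variable phi : module_hom A D.

Lemma tensor_map_balanced :
  balanced (fun x (b : B x) (a : A x) => tensor_mk b (mh phi a)).
Proof.
have [Dl Dr act] := tensor_mk_balanced B D; split=> [x b1 b2 a|x b a1 a2|x y f b a].
- exact: Dl.
- by rewrite raddfD Dr.
- by rewrite (mh_natural phi f a) act.
Qed.

(* [B (x) phi] *)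
Definition tensor_map : {additive tensor B A -> tensor B D} :=
  tensor_lift tensor_map_balanced.

End TensorMap.
Arguments tensor_map {C} B {A D} phi.

(* Homology of B (x) P; the complex is zero in negative degrees. *)
Definition Tor_of C (X : module C) (P : resolution X) n (B : module (op C)) :
    zmodType :=
  if n is k.+1 then
    homology (tensor_map B (res_d P k.+1)) (tensor_map B (res_d P k))
  else homology (tensor_map B (res_d P 0))
         (\0 : {additive _ -> tensor B (res P 0)}).

Definition Tor C n (B : module (op C)) (X : module C) : zmodType :=
  Tor_of (free_resolution X) n B.

Program Definition const_int C : module C :=
  @Module C (fun _ => int) (fun _ _ _ => idfun) _ _.

(* mathcomp's [monoidType] is written multiplicatively: [l * y * r] below is
   l + y + r in additive notation. *)
Section DM.
Variable M : monoidType.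
Local Open Scope group_scope.

(* The arrow (l, y, r), with source y and target y' = l + y + r. *)
Record darrow (y y' : M) := DArrow {
  darrow_l : M;
  darrow_r : M;
  darrowP : darrow_l * y * darrow_r = y'
}.

Lemma darrow_eq y y' (f g : darrow y y') :
  darrow_l f = darrow_l g -> darrow_r f = darrow_r g -> f = g.
Proof.
case: f g => [l r e] [l' r' e'] /= el er; subst l' r'.
by congr DArrow; apply: Prop_irrelevance.
Qed.

Program Definition darrow_id y : darrow y y := @DArrow y y 1 1 _.
Next Obligation. by rewrite mul1g mulg1. Qed.

Program Definition darrow_comp x y z (g : darrow y z) (f : darrow x y) :
    darrow x z :=
  @DArrow x z (darrow_l g * darrow_l f) (darrow_r f * darrow_r g) _.
Next Obligation. by case: g f => l r /= <- [l' r' /= <-]; rewrite !mulgA. Qed.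

Program Definition DM : category :=
  @Category M darrow darrow_id darrow_comp _ _ _.
Next Obligation. by apply: darrow_eq; rewrite /= ?mul1g ?mulg1. Qed.
Next Obligation. by apply: darrow_eq; rewrite /= ?mul1g ?mulg1. Qed.
Next Obligation. by apply: darrow_eq; rewrite /= mulgA. Qed.

End DM.

Definition leech_cohomology (M : monoidType) n (A : module (DM M)) : zmodType :=
  Ext n (const_int (DM M)) A.

Definition leech_homology (M : monoidType) n (B : module (op (DM M))) :
    zmodType :=
  Tor n B (const_int (DM M)).

Section CyclicMonoid.
Local Open Scope nat_scope.

(* The projection of [nat] onto {0, ..., m + q - 1}; for [m <= x < m + q] both
   branches agree, and [wp_ge], [wp_mod] give the characterization used for
   [m <= x]. *)
Definition wp (m q x : nat) : nat :=
  if x < m + q then x else m + (x - m) %% q.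

Section Projection.
Variables (m q : nat) (q_gt0 : 0 < q).

Lemma wp_lt x : wp m q x < m + q.
Proof. by rewrite /wp; case: ifP => // _; rewrite ltn_add2l ltn_mod. Qed.

Lemma wp_id x : x < m + q -> wp m q x = x.
Proof. by rewrite /wp => ->. Qed.

Lemma wp_ge x : m <= x -> wp m q x = m + (x - m) %% q.
Proof.
rewrite /wp => mx; case: ifP => // xmq.
by rewrite modn_small ?subnKC // ltn_subLR.
Qed.

Lemma wp_mod x : m <= x -> wp m q x = x %[mod q].
Proof. by move=> mx; rewrite wp_ge // modnDmr subnKC. Qed.

Lemma wpD x y : wp m q (wp m q x + y) = wp m q (x + y).
Proof.
have [xmq | mqx] := ltnP x (m + q); first by rewrite (wp_id xmq).
have mx : m <= x by apply: leq_trans mqx; rewrite leq_addr.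
rewrite (wp_ge mx) !wp_ge; last 2 first.
- exact: leq_trans mx (leq_addr _ _).
- by rewrite -addnA leq_addr.
by rewrite -addnA addKn modnDml addnBAC.
Qed.

End Projection.

(* The carrier does not depend on the proof of [0 < q], which is needed only for
   [cyclic_zero] and for [wp] to land in 'I_(m + q). *)
Definition cyclic_monoid (m q : nat) (q_gt0 : 0 < q) : Type := 'I_(m + q).

HB.instance Definition _ m q q_gt0 :=
  Finite.copy (@cyclic_monoid m q q_gt0) 'I_(m + q).

Section Instance.
Variables (m q : nat) (q_gt0 : 0 < q).
Local Notation C := (cyclic_monoid m q_gt0).

Definition cyclic_zero : C := Ordinal (ltn_addl m q_gt0).
Definition cyclic_add (x y : C) : C :=
  Ordinal (wp_lt m q_gt0 (nat_of_ord x + nat_of_ord y)).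

Lemma cyclic_addA : associative cyclic_add.
Proof.
by move=> x y z; apply: ord_inj; rewrite /= wpD addnC wpD addnC addnA.
Qed.

Lemma cyclic_add0x : left_id cyclic_zero cyclic_add.
Proof. by move=> x; apply: ord_inj; rewrite /= add0n wp_id. Qed.

Lemma cyclic_addx0 : right_id cyclic_zero cyclic_add.
Proof. by move=> x; apply: ord_inj; rewrite /= addn0 wp_id. Qed.

HB.instance Definition _ :=
  isMonoid.Build C cyclic_addA cyclic_add0x cyclic_addx0.

End Instance.
End CyclicMonoid.

(* Main.v *)
(* Let A = Z[C] = Z[x]/(f) with f = x^(m+q) - x^m monic.  The bimodule A has the
   classical resolution by copies of A (x) A = A[y]/(f(y)), whose differentials
   are alternately multiplication by x - y and by (f(x) - f(y)) / (x - y).  Its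
   C-graded pieces form a resolution of the constant DC-module Z by modules
   represented by the objects wp(k(m+q)), in degree 2k, and wp(k(m+q) + 1), in
   degree 2k+1.  Each differential depends only on the parity of its degree and
   on the object it ends in, and from degree 2 on (degree 1 if m = 1) these
   objects repeat with period 2q/(m,q).  As every projective resolution computes
   the same Ext and Tor, the (co)homology inherits this period. *)

From HB Require Import structures.
From mathcomp Require Import all_boot all_order all_algebra.
From mathcomp Require Import boolp.
From mathcomp Require Import freeg.
From mathcomp Require Import zify.
(* Last, since mathcomp also has constants named [hom] and [cycle]. *)
Require Import Defs.

Set Implicit Arguments.
Unset Strict Implicit.
Unset Printing Implicit Defensive.

Import GRing.Theory.

Local Open Scope ring_scope.

(** * Isomorphisms between homology groups *)

Lemma zmod_iso_trans (U V W : zmodType) :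
  zmod_iso U V -> zmod_iso V W -> zmod_iso U W.
Proof. by move=> [f bf] [g bg]; exists (g \o f); apply: bij_comp. Qed.

Section HomologyEq.
Variables (U V W : zmodType) (f : {additive U -> V}) (g : {additive V -> W}).

Lemma homology_eq (z1 z2 : cycle g) :
  (exists u, f u = cycle_val z1 - cycle_val z2) <->
  \pi_(homology f g)%qT z1 = \pi_(homology f g)%qT z2.
Proof.
split=> [[u fu]|].
  by apply/eqP; rewrite -Quotient.idealrBE inE; apply/asboolP; exists u.
by move/eqP; rewrite -Quotient.idealrBE inE => /asboolP.
Qed.

End HomologyEq.

Section HomologyMap.
Variables (U V W U' V' W' : zmodType).
Variables (f : {additive U -> V}) (g : {additive V -> W}).
Variables (f' : {additive U' -> V'}) (g' : {additive V' -> W'}).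
Variable a : {additive V -> V'}.
Hypothesis a_cycle : forall v, g v = 0 -> g' (a v) = 0.
Hypothesis a_boundary : forall u, exists u', f' u' = a (f u).

Lemma cycle_map_subproof (z : cycle g) : a (cycle_val z) \in cycle_pred g'.
Proof. by case: z => v /=; rewrite !inE => /eqP /a_cycle ->. Qed.

Definition cycle_map (z : cycle g) : cycle g' := Cycle (cycle_map_subproof z).

Definition homology_map (t : homology f g) : homology f' g' :=
  \pi_(homology f' g')%qT (cycle_map (repr t)).

(** Independence of the chosen representative: two representatives differ by a boundary, which [a]
    sends to a boundary. *)
Lemma homology_map_pi z :
  homology_map (\pi_(homology f g)%qT z) =
  \pi_(homology f' g')%qT (cycle_map z).
Proof.
apply/homology_eq => /=.
have [u fu] : exists u, f u =
    cycle_val (repr (\pi_(homology f g)%qT z)) - cycle_val z.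
  by apply/homology_eq; rewrite reprK.
by have [u' fu'] := a_boundary u; exists u'; rewrite fu' fu raddfB.
Qed.

Lemma homology_map_zmod_morphism : zmod_morphism homology_map.
Proof.
move=> s t; rewrite -[s]reprK -[t]reprK -raddfB !homology_map_pi -raddfB.
by congr (\pi_(_)%qT _); apply: val_inj; rewrite /= raddfB.
Qed.

End HomologyMap.

(** Only maps in the middle degree are given. They must respect cycles and boundaries and be
    mutually inverse, on cycles, up to boundaries. *)
Lemma homology_iso (U V W U' V' W' : zmodType)
    (f : {additive U -> V}) (g : {additive V -> W})
    (f' : {additive U' -> V'}) (g' : {additive V' -> W'})
    (a : {additive V -> V'}) (b : {additive V' -> V}) :
  (forall v, g v = 0 -> g' (a v) = 0) ->
  (forall u, exists u', f' u' = a (f u)) ->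
  (forall v, g' v = 0 -> g (b v) = 0) ->
  (forall u, exists u', f u' = b (f' u)) ->
  (forall v, g v = 0 -> exists u, f u = b (a v) - v) ->
  (forall v, g' v = 0 -> exists u, f' u = a (b v) - v) ->
  zmod_iso (homology f g) (homology f' g').
Proof.
move=> ac ab bc bb ba1 ab1.
pose F : {additive homology f g -> homology f' g'} :=
  HB.pack (homology_map (f := f) f' ac)
    (GRing.isZmodMorphism.Build _ _ _ (homology_map_zmod_morphism ac ab)).
exists F, (homology_map (f := f') f bc) => t;
    rewrite -[t]reprK; move: (repr t) => z.
  transitivity
    (homology_map f bc (homology_map f' ac (\pi_(homology f g)%qT z))).
    by [].
  rewrite (homology_map_pi ac ab z) (homology_map_pi bc bb); apply/homology_eq.
  by apply: ba1; apply/eqP; have := valP z; rewrite inE.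
transitivity
  (homology_map f' ac (homology_map f bc (\pi_(homology f' g')%qT z))).
  by [].
rewrite (homology_map_pi bc bb z) (homology_map_pi ac ab); apply/homology_eq.
by apply: ab1; apply/eqP; have := valP z; rewrite inE.
Qed.

(** * Recursive choice, and lifting from projective modules *)

Lemma dependent_choice_from (T : nat -> Type)
    (R : forall n, T n -> T n.+1 -> Prop) (t0 : T 0%N) :
  (forall n (a : T n), exists b, R n a b) ->
  exists t : forall n, T n, t 0%N = t0 /\ forall n, R n (t n) (t n.+1).
Proof.
move=> ex.
pose t := fix t n : T n :=
  if n is k.+1 then sval (cid (ex k (t k))) else t0.
exists t; split=> // n.
by rewrite -[t n.+1]/(sval (cid (ex n (t n)))); case: cid.
Qed.

Section Lifting.
Variables (C : category).

Lemma ker_lift (A B D : module C) (psi : module_hom B D) (f : module_hom A B) :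
  (forall x (a : A x), mh psi (mh f a) = 0) ->
  exists f' : module_hom A (ker_module psi),
    forall x (a : A x), cycle_val (mh f' a) = mh f a.
Proof.
move=> f0.
have fP x (a : A x) : mh f a \in cycle_pred (@mh _ _ _ psi x).
  by rewrite inE /= f0.
unshelve eexists
  (@ModuleHom C A (ker_module psi) (fun x a => Cycle (fP x a)) _ _).
- by move=> x a b; apply: val_inj; rewrite /= raddfB.
- by move=> x y g a; apply: val_inj; rewrite /= mh_natural.
- by [].
Qed.

(** Exactness makes [phi] surjective onto the kernel of [psi], and [f] takes values in that kernel,
    so projectivity applies. *)
Lemma projective_lift (P A B D : module C) (phi : module_hom A B)
    (psi : module_hom B D) (f : module_hom P B) :
  projective P -> mh_exact phi psi ->
  (forall x (a : P x), mh psi (mh f a) = 0) ->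
  exists h : module_hom P A, forall x (a : P x), mh phi (mh h a) = mh f a.
Proof.
move=> projP ex f0.
have [f' f'E] := ker_lift f0.
have phi0 x (a : A x) : mh psi (mh phi a) = 0 by apply/ex; exists a.
have [phi' phi'E] := ker_lift phi0.
have phi'_surj : mh_surj phi'.
  move=> x [b /[dup] + bP]; rewrite inE => /eqP /ex [a ab].
  by exists a; apply: val_inj; rewrite /= phi'E.
have [h hE] := projP _ _ phi' f' phi'_surj.
by exists h => x a; rewrite -phi'E -f'E -hE.
Qed.

End Lifting.

(** * Functoriality and additivity of the tensor product *)

Section TensorMapTheory.
Variables (C : category) (B : module (op C)) (A D E : module C).

Lemma tensor_map_comp (psi : module_hom D E) (phi : module_hom A D) t :
  tensor_map B (mh_comp psi phi) t = tensor_map B psi (tensor_map B phi t).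
Proof.
apply: (@tensor_eq _ B A _ (tensor_map B (mh_comp psi phi))
  (tensor_map B psi \o tensor_map B phi)) => x b a /=.
by rewrite !tensor_liftE.
Qed.

Lemma tensor_map_homotopy (phi : module_hom A A) (u v : module_hom A A) :
  (forall x (a : A x), mh phi a - a = mh u a + mh v a) ->
  forall t, tensor_map B phi t - t = tensor_map B u t + tensor_map B v t.
Proof.
move=> e t; apply/eqP; rewrite subr_eq; apply/eqP.
apply: (@tensor_eq _ B A _ (tensor_map B phi)
  ((tensor_map B u \+ tensor_map B v) \+ idfun)) => x b a /=.
rewrite !tensor_liftE.
have [_ Dr _] := tensor_mk_balanced B A.
by rewrite -!Dr -e subrK.
Qed.

End TensorMapTheory.

(** * Comparison of projective resolutions *)

Section Comparison.
Variables (C : category) (X : module C).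

(* The augmented complex ... -> P_1 -> P_0 -> X, with X in degree 0. *)
Definition aug_obj (P : resolution X) n : module C :=
  if n is k.+1 then res P k else X.

Definition aug_d (P : resolution X) n :
    module_hom (aug_obj P n.+1) (aug_obj P n) :=
  if n is k.+1 then res_d P k else res_aug P.

#[local] Arguments aug_d : simpl never.

(** Every element of X counts as a cycle, so that exactness has one formulation in all degrees,
    surjectivity of the augmentation included. *)
Definition aug_cycle (P : resolution X) n x : aug_obj P n x -> Prop :=
  if n is k.+1 return aug_obj P n x -> Prop then fun a => mh (aug_d P k) a = 0
  else fun=> True.

Lemma aug_exact P n x (b : aug_obj P n x) :
  aug_cycle b <-> exists a, mh (aug_d P n) a = b.
Proof.
case: n b => [|[|n]] b /=; first by split=> // _; apply: res_aug_surj.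
  exact: res_exact0.
exact: res_exact.
Qed.

Lemma aug_dd P n x (a : aug_obj P n.+2 x) :
  mh (aug_d P n) (mh (aug_d P n.+1) a) = 0.
Proof.
have /aug_exact : exists b, mh (aug_d P n.+1) b = mh (aug_d P n.+1) a.
  by exists a.
by [].
Qed.

Lemma aug_lift (P Q : resolution X) k n
    (f : module_hom (res P k) (aug_obj Q n)) :
  (forall x (a : res P k x), aug_cycle (mh f a)) ->
  exists h : module_hom (res P k) (aug_obj Q n.+1),
    forall x (a : res P k x), mh (aug_d Q n) (mh h a) = mh f a.
Proof.
have projP := @res_projective _ _ P k.
case: n f => [|n] f fZ.
  have [h hE] := projP _ _ (res_aug Q) f (@res_aug_surj _ _ Q).
  by exists h => x a; rewrite -[in RHS]hE.
apply: (projective_lift projP _ fZ) => x b.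
exact: (@aug_exact Q n.+1 x b).
Qed.

Definition chain_map (P Q : resolution X)
    (f : forall n, module_hom (aug_obj P n) (aug_obj Q n)) : Prop :=
  forall n x (a : aug_obj P n.+1 x),
    mh (aug_d Q n) (mh (f n.+1) a) = mh (f n) (mh (aug_d P n) a).

Lemma comparison (P Q : resolution X) :
  exists f : forall n, module_hom (aug_obj P n) (aug_obj Q n),
    (forall x (a : X x), mh (f 0%N) a = a) /\ chain_map f.
Proof.
(* Each map is bundled with the fact that it preserves cycles, which is what allows the next
   lift. *)
pose T n := {f : module_hom (aug_obj P n) (aug_obj Q n) |
  forall x (a : aug_obj P n x), aug_cycle a -> aug_cycle (mh f a)}.
have id_add x : zmod_morphism (fun a : X x => a) by [].
have id_nat x y (g : hom x y) (a : X x) : mact X g a = mact X g a by [].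
pose t0 : T 0%N := exist _ (ModuleHom id_add id_nat) (fun _ _ _ => I).
pose R n (f : T n) (g : T n.+1) := forall x (a : aug_obj P n.+1 x),
  mh (aug_d Q n) (mh (sval g) a) = mh (sval f) (mh (aug_d P n) a).
have [n [f fZ]|t [t0E tR]] := @dependent_choice_from T R t0.
  have fdZ x (a : res P n x) : aug_cycle (mh (mh_comp f (aug_d P n)) a).
    by apply: fZ; apply/aug_exact; exists a.
  have [h hE] := aug_lift fdZ.
  unshelve eexists (exist _ h _); last by [].
  by move=> x a /= a0; rewrite hE /= a0 raddf0.
by exists (fun n => sval (t n)); split=> [x a|//]; rewrite t0E.
Qed.

(** Starting from h_0 = 0, h_(n+1) is a lift of f_(n+1) - h_n d along d. The invariant carried along
    is that this difference takes values in cycles. *)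
Lemma null_homotopy (P Q : resolution X)
    (f : forall n, module_hom (aug_obj P n) (aug_obj Q n)) :
  chain_map f -> (forall x (a : X x), mh (f 0%N) a = 0) ->
  exists h : forall n, module_hom (aug_obj P n) (aug_obj Q n.+1),
    forall n x (a : aug_obj P n.+1 x),
      mh (f n.+1) a = mh (aug_d Q n.+1) (mh (h n.+1) a) +
                      mh (h n) (mh (aug_d P n) a).
Proof.
move=> fd f0.
pose T n := {h : module_hom (aug_obj P n) (aug_obj Q n.+1) |
  forall x (a : aug_obj P n.+1 x),
    aug_cycle (mh (f n.+1) a - mh h (mh (aug_d P n) a))}.
have t0P x (a : aug_obj P 1 x) :
    @aug_cycle Q 1 x (mh (f 1%N) a -
      mh (0 : module_hom (aug_obj P 0) (aug_obj Q 1)) (mh (aug_d P 0) a)).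
  by rewrite /aug_cycle subr0 fd f0.
pose t0 : T 0%N := exist _ 0 t0P.
pose R n (h : T n) (k : T n.+1) := forall x (a : aug_obj P n.+1 x),
  mh (aug_d Q n.+1) (mh (sval k) a) =
  mh (f n.+1) a - mh (sval h) (mh (aug_d P n) a).
have [n [h hZ]|t [_ tR]] := @dependent_choice_from T R t0; last first.
  by exists (fun n => sval (t n)) => n x a; rewrite tR subrK.
have [k kE] := aug_lift (f := f n.+1 - mh_comp h (aug_d P n)) hZ.
unshelve eexists (exist _ k _); last by [].
move=> x a.
rewrite -[aug_cycle _]/(mh (aug_d Q n.+1)
  (mh (f n.+2) a - mh k (mh (aug_d P n.+1) a)) = 0).
(* d (f_(n+2) - h_(n+1) d) = f_(n+1) d - (f_(n+1) - h_n d) d = h_n d d = 0. *)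
rewrite raddfB /= (fd n.+1 x a) [X in _ - X](kE x (mh (aug_d P n.+1) a)).
by rewrite -[mh (_ - _) _]/(_ - mh h (mh (aug_d P n) _)) aug_dd raddf0 subr0
  subrr.
Qed.

(** Comparison maps f and g both extend the identity of X, so g f - 1 and f g - 1 vanish on X and
    are null-homotopic. *)
Lemma homotopy_equivalence (P Q : resolution X) :
  exists (f : forall n, module_hom (aug_obj P n) (aug_obj Q n))
         (g : forall n, module_hom (aug_obj Q n) (aug_obj P n))
         (h : forall n, module_hom (aug_obj P n) (aug_obj P n.+1))
         (k : forall n, module_hom (aug_obj Q n) (aug_obj Q n.+1)),
    [/\ chain_map f, chain_map g,
        forall n x (a : aug_obj P n.+1 x), mh (g n.+1) (mh (f n.+1) a) - a =
          mh (aug_d P n.+1) (mh (h n.+1) a) + mh (h n) (mh (aug_d P n) a)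
      & forall n x (a : aug_obj Q n.+1 x), mh (f n.+1) (mh (g n.+1) a) - a =
          mh (aug_d Q n.+1) (mh (k n.+1) a) + mh (k n) (mh (aug_d Q n) a)].
Proof.
have id_homotopic (P' Q' : resolution X) f g : @chain_map P' Q' f ->
    @chain_map Q' P' g -> (forall x (a : X x), mh (f 0%N) a = a) ->
    (forall x (a : X x), mh (g 0%N) a = a) ->
    exists h : forall n, module_hom (aug_obj P' n) (aug_obj P' n.+1),
    forall n x (a : aug_obj P' n.+1 x), mh (g n.+1) (mh (f n.+1) a) - a =
      mh (aug_d P' n.+1) (mh (h n.+1) a) + mh (h n) (mh (aug_d P' n) a).
  move=> fd gd f0 g0.
  have id_add n x : zmod_morphism (fun a : aug_obj P' n x => a) by [].
  have id_nat n x y (u : hom x y) (a : aug_obj P' n x) :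
    mact (aug_obj P' n) u a = mact (aug_obj P' n) u a by [].
  pose one n := ModuleHom (@id_add n) (@id_nat n).
  apply: (@null_homotopy P' P' (fun n => mh_comp (g n) (f n) - one n)).
    by move=> n x a; rewrite /= raddfB /= gd fd.
  by move=> x a; rewrite /= f0 g0 subrr.
have [f [f0 fd]] := comparison P Q.
have [g [g0 gd]] := comparison Q P.
have [h hE] := id_homotopic P Q f g fd gd f0 g0.
have [k kE] := id_homotopic Q P g f gd fd g0 f0.
by exists f, g, h, k; split.
Qed.

(** Degree n + 1 of the resolution is [aug_obj] at n + 2, hence the indices of f and g. The
    auxiliary facts are stated for arbitrary P' and Q' so as to serve both directions. *)
Lemma Ext_of_iso (P Q : resolution X) n (A : module C) :
  zmod_iso (Ext_of P n.+1 A) (Ext_of Q n.+1 A).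
Proof.
have [f [g [h [k [fd gd hE kE]]]]] := homotopy_equivalence P Q.
have cyc (P' Q' : resolution X) f' : @chain_map P' Q' f' ->
    forall v, precomp A (res_d Q' n.+1) v = 0 ->
    precomp A (res_d P' n.+1) (precomp A (f' n.+2) v) = 0.
  move=> f'd v v0; apply: module_homP => x a /=.
  rewrite -(f'd n.+2 x a).
  by have := congr1 (fun w : module_hom _ A => mh w (mh (f' n.+3) a)) v0.
have bnd (P' Q' : resolution X) f' : @chain_map P' Q' f' ->
    forall u, exists u', precomp A (res_d P' n) u' =
    precomp A (f' n.+2) (precomp A (res_d Q' n) u).
  move=> f'd u; exists (precomp A (f' n.+1) u); apply: module_homP => x a /=.
  by rewrite -(f'd n.+1 x a).
have hom (P' Q' : resolution X) f' g'
    (h' : forall n, module_hom (aug_obj P' n) (aug_obj P' n.+1)) :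
    (forall n x (a : aug_obj P' n.+1 x),
      mh (g' n.+1 : module_hom (aug_obj Q' n.+1) (aug_obj P' n.+1))
        (mh (f' n.+1) a) - a =
      mh (aug_d P' n.+1) (mh (h' n.+1) a) + mh (h' n) (mh (aug_d P' n) a)) ->
    forall v, precomp A (res_d P' n.+1) v = 0 ->
    exists u, precomp A (res_d P' n) u =
      precomp A (f' n.+2) (precomp A (g' n.+2) v) - v.
  move=> h'E v v0; exists (precomp A (h' n.+1) v); apply: module_homP => x a /=.
  rewrite -raddfB h'E raddfD /=.
  have -> : mh v (mh (res_d P' n.+1) (mh (h' n.+2) a)) = 0.
    by have := congr1 (fun w : module_hom _ A => mh w (mh (h' n.+2) a)) v0.
  by rewrite add0r.
apply: (@homology_iso _ _ _ _ _ _ _ _ _ _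
  (precomp A (g n.+2)) (precomp A (f n.+2))).
- exact: cyc.
- exact: bnd.
- exact: cyc.
- exact: bnd.
- exact: hom hE.
- exact: hom kE.
Qed.

Lemma Tor_of_iso (P Q : resolution X) n (B : module (op C)) :
  zmod_iso (Tor_of P n.+1 B) (Tor_of Q n.+1 B).
Proof.
have [f [g [h [k [fd gd hE kE]]]]] := homotopy_equivalence P Q.
have comm (P' Q' : resolution X) f' : @chain_map P' Q' f' -> forall j t,
    tensor_map B (res_d Q' j) (tensor_map B (f' j.+2) t) =
    tensor_map B (f' j.+1) (tensor_map B (res_d P' j) t).
  move=> f'd j t; rewrite -!tensor_map_comp; congr (tensor_map B _ t).
  by apply: module_homP => x a; apply: (f'd j.+1).
have cyc (P' Q' : resolution X) f' : @chain_map P' Q' f' ->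
    forall v, tensor_map B (res_d P' n) v = 0 ->
    tensor_map B (res_d Q' n) (tensor_map B (f' n.+2) v) = 0.
  by move=> f'd v v0; rewrite comm // v0 raddf0.
have bnd (P' Q' : resolution X) f' : @chain_map P' Q' f' ->
    forall u, exists u', tensor_map B (res_d Q' n.+1) u' =
    tensor_map B (f' n.+2) (tensor_map B (res_d P' n.+1) u).
  by move=> f'd u; exists (tensor_map B (f' n.+3) u); rewrite comm.
have hom (P' Q' : resolution X) f' g'
    (h' : forall n, module_hom (aug_obj P' n) (aug_obj P' n.+1)) :
    (forall n x (a : aug_obj P' n.+1 x),
      mh (g' n.+1 : module_hom (aug_obj Q' n.+1) (aug_obj P' n.+1))
        (mh (f' n.+1) a) - a =
      mh (aug_d P' n.+1) (mh (h' n.+1) a) + mh (h' n) (mh (aug_d P' n) a)) ->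
    forall v, tensor_map B (res_d P' n) v = 0 ->
    exists u, tensor_map B (res_d P' n.+1) u =
      tensor_map B (g' n.+2) (tensor_map B (f' n.+2) v) - v.
  move=> h'E v v0; exists (tensor_map B (h' n.+2) v).
  rewrite -[X in _ = X - _]tensor_map_comp.
  rewrite (@tensor_map_homotopy _ _ _ _
    (mh_comp (aug_d P' n.+2) (h' n.+2)) (mh_comp (h' n.+1) (res_d P' n)));
    last exact: (h'E n.+1).
  by rewrite !tensor_map_comp v0 raddf0 addr0.
apply: (@homology_iso _ _ _ _ _ _ _ _ _ _
  (tensor_map B (f n.+2)) (tensor_map B (g n.+2))).
- exact: cyc.
- exact: bnd.
- exact: cyc.
- exact: bnd.
- exact: hom hE.
- exact: hom kE.
Qed.

End Comparison.

(** * Additivity of module morphisms at one object *)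

Section ModuleHomTheory.
Variables (C : category) (A B : module C) (phi : module_hom A B) (x : obj C).

Lemma mh0 : mh phi 0 = 0 :> B x.
Proof. exact: (raddf0 (@mh _ _ _ phi x)). Qed.

Lemma mhN (a : A x) : mh phi (- a) = - mh phi a.
Proof. exact: (raddfN (@mh _ _ _ phi x)). Qed.

Lemma mhB (a b : A x) : mh phi (a - b) = mh phi a - mh phi b.
Proof. exact: (raddfB (@mh _ _ _ phi x)). Qed.

Lemma mhMz (a : A x) (n : int) : mh phi (a *~ n) = mh phi a *~ n.
Proof. exact: (raddfMz (@mh _ _ _ phi x)). Qed.

Lemma mh_sum (m n : nat) (F : nat -> A x) :
  mh phi (\sum_(m <= i < n) F i) = \sum_(m <= i < n) mh phi (F i).
Proof. exact: (raddf_sum (@mh _ _ _ phi x)). Qed.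

End ModuleHomTheory.

(** * Representable modules *)

Section Representable.
Variables (C : category) (y : obj C).

Definition rep_obj (z : obj C) : zmodType := {freeg {classic hom y z} / int}.

Definition rep_gen z (f : hom y z) : rep_obj z := << f : {classic hom y z} >>.

Definition rep_lift z (V : zmodType) (u : hom y z -> V) : rep_obj z -> V :=
  free_lift (u : {classic hom y z} -> V).
HB.instance Definition _ z V u :=
  GRing.Additive.copy (@rep_lift z V u) (@rep_lift z V u).

Lemma rep_liftE z (V : zmodType) (u : hom y z -> V) f :
  rep_lift u (rep_gen f) = u f.
Proof. exact: free_liftU. Qed.

Lemma rep_eq z (V : zmodType) (g h : {additive rep_obj z -> V}) :
  (forall f, g (rep_gen f) = h (rep_gen f)) -> g =1 h.
Proof.
move=> gh t; rewrite (@free_lift_unique _ _ (fun k => h << k >>) g) //.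
by rewrite -(@free_lift_unique _ _ (fun k => h << k >>) h).
Qed.

Definition rep_act z z' (g : hom z z') : rep_obj z -> rep_obj z' :=
  rep_lift (fun f => rep_gen (comp g f)).
HB.instance Definition _ z z' (g : hom z z') :=
  GRing.Additive.copy (rep_act g) (rep_act g).

Program Definition rep : module C :=
  @Module C rep_obj (fun z z' g => rep_act g) _ _.
Next Obligation.
apply: (rep_eq (g := rep_act (idm x)) (h := idfun)) => f /=.
by rewrite [LHS]rep_liftE comp_idl.
Qed.
Next Obligation.
apply: (rep_eq (g := rep_act (comp g f)) (h := rep_act g \o rep_act f)) => h /=.
by rewrite /rep_act !rep_liftE comp_assoc.
Qed.

(** One direction of the additive Yoneda lemma. *)
Program Definition rep_ext (A : module C) (a : A y) : module_hom rep A :=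
  @ModuleHom C rep A (fun z => rep_lift (fun f => mact A f a)) _ _.
Next Obligation. by move=> s t; apply: raddfB. Qed.
Next Obligation.
rename x into z, y0 into z'.
apply: (rep_eq (g := rep_lift (fun f => mact A f a) \o rep_act f)
  (h := mact A f \o rep_lift (fun f => mact A f a))) => g /=.
by rewrite [rep_act _ _]rep_liftE !rep_liftE mact_comp.
Qed.

Lemma rep_extE (A : module C) (a : A y) z (f : hom y z) :
  mh (rep_ext a) (rep_gen f) = mact A f a.
Proof. exact: rep_liftE. Qed.

(** By Yoneda it is enough to lift the image of the identity of y. *)
Lemma rep_projective : projective rep.
Proof.
move=> A B g f gS.
have [a ga] := gS y (mh f (rep_gen (idm y))).
exists (rep_ext a); apply: module_homP => z.
apply: (@rep_eq z (B z) (@mh _ _ _ g z \o rep_lift (fun k => mact A k a))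
  (@mh _ _ _ f z : {additive rep z -> B z})) => h /=.
rewrite rep_liftE (mh_natural g h a) ga -(mh_natural f h) /=.
by rewrite [rep_act _ _]rep_liftE comp_idr.
Qed.

End Representable.

(** * Arrows over the cyclic monoid, written as monomials *)

Section Cyclic.
Variables (m q : nat) (q_gt0 : (0 < q)%N).
Local Notation M := (cyclic_monoid m q_gt0).
Local Notation w := (m + q).-1%N.

Definition el (n : nat) : M := Ordinal (wp_lt m q_gt0 n).

Lemma elD a b : (el a * el b)%g = el (a + b).
Proof. by apply: ord_inj; rewrite /= wpD // addnC wpD // addnC. Qed.

Lemma el_val (x : M) : el (nat_of_ord x) = x.
Proof. by apply: ord_inj; rewrite /= wp_id. Qed.

Lemma el0 : el 0 = 1%g.
Proof. by apply: ord_inj; rewrite /= wp_id // ltn_addl. Qed.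

Lemma cyclic_mulC (x y : M) : (x * y)%g = (y * x)%g.
Proof. by rewrite -[x]el_val -[y]el_val !elD addnC. Qed.

Lemma el_period n t : (m <= n)%N -> el (n + t * q) = el n.
Proof.
move=> mn; apply: ord_inj; rewrite /= !wp_ge ?(leq_trans mn) ?leq_addr //.
by rewrite -addnBAC // [(n - m + _)%N]addnC modnMDl.
Qed.

Lemma mul_elD (u : M) a b : (u * el a * el b)%g = (u * el (a + b))%g.
Proof. by rewrite -mulgA elD. Qed.

Lemma el_sandwich a b (y : M) : (el a * y * el b)%g = (y * el (a + b))%g.
Proof. by rewrite (cyclic_mulC (el a)) -mulgA elD. Qed.

(** The target z is a separate argument, compared classically with l + y + r, so that computations
    with exponents need no transport between groups. *)
Definition genM (y z l r : M) : rep (y : obj (DM M)) z :=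
  if pselect ((l * y * r)%g = z) is left e then
    rep_gen (DArrow e : @hom (DM M) y z)
  else 0.

(* [gen y z a b] is the arrow (a, y, b) of target [z]; the junk value [0] is
   taken when a + y + b is not [z]. *)
Definition gen (y z : M) (a b : nat) := genM y z (el a) (el b).

Lemma gen_congr y z a b a' b' : el a = el a' -> el b = el b' ->
  gen y z a b = gen y z a' b'.
Proof. by rewrite /gen => -> ->. Qed.

Lemma rep_gen_el y z (f : @hom (DM M) y z) :
  rep_gen f = gen y z (nat_of_ord (darrow_l f)) (nat_of_ord (darrow_r f)).
Proof.
rewrite /gen /genM !el_val; case: pselect => [e|]; last by case: f.
by congr rep_gen; apply: darrow_eq.
Qed.

Lemma gen_arrow y z a b : (y * el (a + b))%g = z ->
  exists f : @hom (DM M) y z,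
    [/\ gen y z a b = rep_gen f, darrow_l f = el a & darrow_r f = el b].
Proof.
rewrite -el_sandwich => e; exists (DArrow e : @hom (DM M) y z); split=> //.
rewrite /gen /genM; case: pselect => // e'.
by congr rep_gen; apply: darrow_eq.
Qed.

(** The right component of an arrow has a representative below m + q. The contracting homotopies are
    computed from this reduced exponent. *)
Lemma gen_ext (y z : M) (V : zmodType)
    (g h : {additive rep (y : obj (DM M)) z -> V}) :
  (forall a b, (b < m + q)%N -> (y * el (a + b))%g = z ->
     g (gen y z a b) = h (gen y z a b)) ->
  g =1 h.
Proof.
move=> gh; apply: rep_eq => f; rewrite rep_gen_el; apply: gh => //.
by rewrite -el_sandwich !el_val; case: f.
Qed.

Lemma mact_gen (y z z' : M) (f : @hom (DM M) z z') a b l r :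
  (y * el (a + b))%g = z -> darrow_l f = el l -> darrow_r f = el r ->
  mact (rep (y : obj (DM M))) f (gen y z a b) = gen y z' (l + a) (b + r).
Proof.
move=> /gen_arrow[g [-> gl gr]] fl fr.
rewrite [LHS]rep_liftE rep_gen_el /= gl gr fl fr.
apply: gen_congr; rewrite -elD.
  exact: (el_val (el l * el a)%g).
exact: (el_val (el b * el r)%g).
Qed.

(** * The two differentials, and their composites *)

(** Reading [gen u z a b] as x^a y^b, this is multiplication by x - y. *)
Definition d_odd (u : M) :
    module_hom (rep ((u * el 1)%g : obj (DM M))) (rep (u : obj (DM M))) :=
  rep_ext (A := rep (u : obj (DM M)))
    (gen u (u * el 1)%g 1 0 - gen u (u * el 1)%g 0 1).

Lemma d_odd_gen u z a b : (u * el 1 * el (a + b))%g = z ->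
  mh (d_odd u) (gen (u * el 1)%g z a b) = gen u z a.+1 b - gen u z a b.+1.
Proof.
move=> /gen_arrow[f [-> fl fr]]; rewrite rep_extE raddfB /=.
rewrite (mact_gen _ fl fr) ?addn0 // (mact_gen _ fl fr) ?addn0 //.
by rewrite addn1 add0n add1n.
Qed.

(** This is x^a y^b (x^n - y^n) / (x - y). *)
Definition norm (v z : M) n a b :=
  \sum_(0 <= i < n) gen v z (a + i) (b + (n.-1 - i)).

(** Multiplication by (f(x) - f(y)) / (x - y), where f(x) = x^(m+q) - x^m. *)
Definition d_even (v : M) :
    module_hom (rep ((v * el w)%g : obj (DM M))) (rep (v : obj (DM M))) :=
  rep_ext (A := rep (v : obj (DM M)))
    (norm v (v * el w)%g (m + q) 0 0 - norm v (v * el w)%g m 0 0).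

(** The degree condition is guarded by n > 0 because the sum is empty for n = 0, a case that occurs
    when m = 0. *)
Lemma mact_norm (v z z' : M) (f : @hom (DM M) z z') n a b :
  ((0 < n)%N -> (v * el n.-1)%g = z) ->
  darrow_l f = el a -> darrow_r f = el b ->
  mact (rep (v : obj (DM M))) f (norm v z n 0 0) = norm v z' n a b.
Proof.
move=> vz fl fr; rewrite /norm raddf_sum; apply: eq_big_nat => i /andP[_ ltin].
rewrite /= (mact_gen _ fl fr) ?add0n; last first.
  by rewrite subnKC ?vz //; lia.
by rewrite addnC [(_ + b)%N]addnC.
Qed.

Lemma d_even_gen u z a b : let v := (u * el 1)%g in
  (v * el w * el (a + b))%g = z ->
  mh (d_even v) (gen (v * el w)%g z a b) =
  norm v z (m + q) a b - norm v z m a b.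
Proof.
move=> v /gen_arrow[f [-> fl fr]]; rewrite rep_extE raddfB /=.
rewrite !(mact_norm _ fl fr) // => m_gt0.
rewrite /v !mul_elD; congr (_ * _)%g.
(* Since 1 + w = m + q, both sides are [el m]. *)
rewrite -[RHS](@el_period _ 0) ?addn0; last by lia.
by rewrite -[LHS](@el_period _ 1); [congr el|]; lia.
Qed.

(** (x - y) times (x^n - y^n) / (x - y), expanded term by term. *)
Lemma norm_telescope (u z : M) n a b :
  \sum_(0 <= i < n) (gen u z (a + i).+1 (b + (n.-1 - i)) -
                     gen u z (a + i) (b + (n.-1 - i)).+1) =
  gen u z (a + n) b - gen u z a (b + n).
Proof.
transitivity (\sum_(0 <= i < n) (gen u z (a + i.+1) (b + (n - i.+1)) -
                                 gen u z (a + i) (b + (n - i)))).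
  apply: eq_big_nat => i /andP[_ ltin]; congr (gen _ _ _ _ - gen _ _ _ _); lia.
by rewrite (telescope_sumr (fun i => gen u z (a + i) (b + (n - i)))) // !addn0
  subnn addn0 subn0.
Qed.

Lemma norm_shift u z n a b :
  norm u z n a.+1 b - norm u z n a b.+1 = gen u z (a + n) b - gen u z a (b + n).
Proof. by rewrite -norm_telescope -sumrB. Qed.

(** This is x^a y^b (f(x) - f(y)) = 0: both x^(m+q) = x^m and y^(m+q) = y^m hold. *)
Lemma gen_wrap u z a b :
  gen u z (a + (m + q)) b - gen u z a (b + (m + q)) =
  gen u z (a + m) b - gen u z a (b + m).
Proof.
have e c : el (c + (m + q)) = el (c + m).
  by have := el_period 1 (leq_addl c m); rewrite mul1n addnA.
by congr (_ - _); apply: gen_congr.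
Qed.

Lemma d_odd_norm u z n a b :
  ((0 < n)%N -> (u * el 1 * el (a + b + n.-1))%g = z) ->
  mh (d_odd u) (norm (u * el 1)%g z n a b) =
  gen u z (a + n) b - gen u z a (b + n).
Proof.
move=> e; rewrite /norm mh_sum -norm_telescope.
apply: eq_big_nat => i /andP[_ ltin]; rewrite d_odd_gen // -e; last by lia.
by congr (_ * el _)%g; lia.
Qed.

(* Both sums of [norm]s produced by [d_even] lie in the same degree because
   [v] is a multiple of the generator [el 1]. *)
Lemma degree_wrap u c :
  (u * el 1 * el w * el c = u * el 1 * el (c + (m + q).-1))%g.
Proof. by rewrite !mul_elD; congr (_ * el _)%g; lia. Qed.

Lemma degree_wrap_m u c : (0 < m)%N ->
  (u * el 1 * el w * el c = u * el 1 * el (c + m.-1))%g.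
Proof.
move=> m_gt0; rewrite !mul_elD; congr (_ * _)%g.
rewrite -(@el_period (1 + (c + m.-1)) 1); last by lia.
by congr el; lia.
Qed.

(** The product of the two multipliers is f(x) - f(y), which is 0 by [gen_wrap]. *)
Lemma d_odd_even u z (t : rep ((u * el 1 * el w)%g : obj (DM M)) z) :
  mh (d_odd u) (mh (d_even (u * el 1)%g) t) = 0.
Proof.
apply: (gen_ext
  (g := @mh _ _ _ (d_odd u) z \o @mh _ _ _ (d_even (u * el 1)%g) z)
  (h := \0)) => a b _ e.
change (mh (d_odd u) (mh (d_even (u * el 1)%g) (gen _ z a b)) = 0).
rewrite d_even_gen // mhB !d_odd_norm ?gen_wrap ?subrr //.
  by move=> m_gt0; rewrite -e degree_wrap_m.
by move=> _; rewrite -e degree_wrap.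
Qed.

Lemma d_even_odd u z
    (t : rep ((u * el 1 * el w * el 1)%g : obj (DM M)) z) :
  mh (d_even (u * el 1)%g) (mh (d_odd (u * el 1 * el w)%g) t) = 0.
Proof.
apply: (gen_ext (g := @mh _ _ _ (d_even (u * el 1)%g) z \o
  @mh _ _ _ (d_odd (u * el 1 * el w)%g) z) (h := \0)) => a b _ e.
change (mh (d_even (u * el 1)%g) (mh (d_odd (u * el 1 * el w)%g)
  (gen (u * el 1 * el w * el 1)%g z a b)) = 0).
rewrite d_odd_gen // mhB !d_even_gen ?addSn ?addnS; last 2 first.
- by rewrite -e !mul_elD.
- by rewrite -e !mul_elD.
(* The four sums are paired by length, m + q and m, and each pair telescopes. *)
rewrite opprB [norm _ _ m _ _ - _]addrC addrACA norm_shift.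
by rewrite [- norm _ _ _ _ _ + _]addrC -[X in _ + X]opprB norm_shift
  gen_wrap subrr.
Qed.

(** * Exactness in positive degrees *)

(* Contracting homotopy: minus the quotient of y^r by y - x for [s_even], and
   the quotient of y^r by (f(y) - f(x)) / (y - x), a monic polynomial in y of
   degree m + q - 1, for [s_odd]. *)
Definition s_even (u z : M) : rep (u : obj (DM M)) z ->
    rep ((u * el 1)%g : obj (DM M)) z :=
  rep_lift (fun f : @hom (DM M) u z =>
    - norm (u * el 1)%g z
        (nat_of_ord (darrow_r f)) (nat_of_ord (darrow_l f)) 0).
HB.instance Definition _ u z := GRing.Additive.copy (@s_even u z) (@s_even u z).

Definition s_odd (v z : M) : rep (v : obj (DM M)) z ->
    rep ((v * el w)%g : obj (DM M)) z :=
  rep_lift (fun f : @hom (DM M) v z =>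
    if nat_of_ord (darrow_r f) == w then
      gen (v * el w)%g z (nat_of_ord (darrow_l f)) 0
    else 0).
HB.instance Definition _ v z := GRing.Additive.copy (@s_odd v z) (@s_odd v z).

Lemma norm_congr v z n a a' b :
  el a = el a' -> norm v z n a b = norm v z n a' b.
Proof.
by move=> e; apply: eq_bigr => i _; apply: gen_congr; rewrite // -!elD e.
Qed.

(** The exponent b must be reduced because it becomes the number of terms; a may be any
    representative. *)
Lemma s_even_gen u z a b : (b < m + q)%N -> (u * el (a + b))%g = z ->
  s_even (gen u z a b) = - norm (u * el 1)%g z b a 0.
Proof.
move=> ltb /gen_arrow[f [-> fl fr]]; rewrite /s_even rep_liftE fl fr.
by congr (- _); rewrite (norm_congr _ _ _ _ (el_val (el a))) /= wp_id.
Qed.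

Lemma s_odd_gen v z a b : (v * el (a + b))%g = z ->
  s_odd (gen v z a b) = if wp m q b == w then gen (v * el w)%g z a 0 else 0.
Proof.
move=> /gen_arrow[f [-> fl fr]]; rewrite /s_odd rep_liftE fl fr /=.
by case: ifP => // _; apply: gen_congr => //; apply: (el_val (el a)).
Qed.

(** This and [wp_top_ge] locate the terms of y^b (f(x) - f(y)) / (x - y) whose power of y reduces to
    y^w. For i < b the i-th terms of the two sums reduce alike, as their exponents are at least m
    and differ by q. *)
Lemma wp_top_lt b i : (b < m + q)%N -> (i < m)%N ->
  (wp m q (b + ((m + q).-1 - i)) == w) =
  (i == b) || (wp m q (b + (m.-1 - i)) == w) :> bool.
Proof.
move=> ltb lti; have [ltib|ltbi|->] := ltngtP i b; rewrite /=.
- have -> : (b + ((m + q).-1 - i) = b + (m.-1 - i) + q)%N by lia.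
  have mb : (m <= b + (m.-1 - i))%N by lia.
  by have /(congr1 (@nat_of_ord _)) /= := el_period 1 mb; rewrite mul1n => ->.
- rewrite !wp_id; lia.
- rewrite !wp_id; lia.
Qed.

Lemma wp_top_ge b i : (b < m + q)%N -> (m <= i < m + q)%N ->
  (wp m q (b + ((m + q).-1 - i)) == w) = (i == b).
Proof.
move=> ltb /andP[lemi lti]; have [ltib|ltbi|->] := ltngtP i b.
- rewrite wp_ge; last by lia.
  have -> : (b + ((m + q).-1 - i) - m = q + (b - i).-1)%N by lia.
  rewrite modnDl modn_small; lia.
- rewrite wp_id; lia.
- rewrite wp_id; lia.
Qed.

Lemma s_odd_norm v z n a b : ((0 < n)%N -> (v * el (a + b + n.-1))%g = z) ->
  s_odd (norm v z n a b) =
  \sum_(0 <= i < n) if wp m q (b + (n.-1 - i)) == w then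
    gen (v * el w)%g z (a + i) 0 else 0.
Proof.
move=> e; rewrite /norm raddf_sum; apply: eq_big_nat => i /andP[_ lti].
by rewrite /= s_odd_gen // -e; [congr (_ * el _)%g|]; lia.
Qed.

(** [s_odd] extracts the coefficient of y^w. All contributions cancel or vanish except the term i =
    b of the long sum, which gives x^(a+b). *)
Lemma s_odd_d_even u z a b : (b < m + q)%N ->
  (u * el 1 * el w * el (a + b))%g = z ->
  s_odd (mh (d_even (u * el 1)%g) (gen (u * el 1 * el w)%g z a b)) =
  gen (u * el 1 * el w)%g z (a + b) 0.
Proof.
move=> ltb e; rewrite d_even_gen // raddfB /=.
rewrite !s_odd_norm; last 2 first.
- by move=> m_gt0; rewrite -e degree_wrap_m.
- by move=> _; rewrite -e degree_wrap.
rewrite (big_cat_nat (n := m)) ?leq_addr //= addrAC -sumrB.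
pose F i := if i == b then gen (u * el 1 * el w)%g z (a + i) 0 else 0.
transitivity (\sum_(0 <= i < m) F i + \sum_(m <= i < m + q) F i).
  congr (_ + _); apply: eq_big_nat => i; last by move=> /wp_top_ge ->.
  move=> /andP[_ lti]; rewrite wp_top_lt // /F.
  (* At i = b the short sum has y-exponent m - 1 < w, so nothing is subtracted; elsewhere the two
     terms cancel. *)
  case: eqP => [ib|_] /=; last by rewrite subrr.
  by rewrite ifN ?subr0 // wp_id; lia.
rewrite -(big_cat_nat (n := m) (p := m + q)) ?leq_addr //=.
by rewrite -big_mkcond big_nat1_eq ltb.
Qed.

(** On x^a y^b the two summands are x^a y^b - x^(a+b) and x^(a+b). *)
Lemma homotopy_even u z (t : rep ((u * el 1 * el w)%g : obj (DM M)) z) :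
  t = mh (d_odd (u * el 1 * el w)%g) (s_even t) +
      s_odd (mh (d_even (u * el 1)%g) t).
Proof.
set v := (u * el 1 * el w)%g in t *.
apply: (gen_ext (g := idfun) (h := (@mh _ _ _ (d_odd v) z \o @s_even v z) \+
  (@s_odd (u * el 1)%g z \o @mh _ _ _ (d_even (u * el 1)%g) z))) => a b ltb e.
change (gen v z a b = mh (d_odd v) (s_even (gen v z a b)) +
  s_odd (mh (d_even (u * el 1)%g) (gen v z a b))).
rewrite s_odd_d_even // s_even_gen // mhN d_odd_norm; last first.
  by move=> b_gt0; rewrite -e mul_elD; congr (_ * el _)%g; lia.
by rewrite opprB add0n subrK.
Qed.

Lemma normS v z n a b :
  norm v z n.+1 a b = gen v z a (b + n) + norm v z n a.+1 b.
Proof.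
rewrite /norm big_nat_recl // addn0 subn0; congr (_ + _).
by apply: eq_big_nat => i lti; congr (gen _ _ _ _); lia.
Qed.

Lemma s_evenB u z (s t : rep (u : obj (DM M)) z) :
  s_even (s - t) = s_even s - s_even t.
Proof. exact: (raddfB (@s_even u z)). Qed.

Lemma homotopy_odd u z (t : rep ((u * el 1)%g : obj (DM M)) z) :
  t = mh (d_even (u * el 1)%g) (s_odd t) + s_even (mh (d_odd u) t).
Proof.
set v := (u * el 1)%g in t *.
apply: (gen_ext (g := idfun) (h := (@mh _ _ _ (d_even v) z \o @s_odd v z) \+
  (@s_even u z \o @mh _ _ _ (d_odd u) z))) => a b ltb e.
change (gen v z a b = mh (d_even v) (s_odd (gen v z a b)) +
  s_even (mh (d_odd u) (gen v z a b))).
have e' : (u * el (a + b.+1))%g = z by rewrite -e mul_elD addnS.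
rewrite s_odd_gen // wp_id // d_odd_gen // s_evenB.
rewrite s_even_gen //; last by rewrite addSn -addnS.
(* For b < w, [s_odd] gives 0 and y^(b+1) is still reduced, so [normS] leaves exactly x^a y^b. *)
have [bw|bw] := eqVneq b w; last first.
  rewrite mh0 add0r s_even_gen //; last by lia.
  by rewrite opprK normS add0n addrC addrK.
have wS : w.+1 = (m + q)%N by lia.
have elm : el b.+1 = el m.
  by rewrite bw wS; have := el_period 1 (leqnn m); rewrite mul1n.
have e'' : (u * el (a + m))%g = z by rewrite -e' -!elD elm.
(* For b = w, y^(b+1) = y^(m+q) must first be reduced to y^m. The resulting [norm] of length m
   cancels the one from [d_even]. *)
rewrite (gen_congr u z (erefl (el a)) elm) s_even_gen //; last by lia.
rewrite d_even_gen; last by rewrite degree_wrap -e bw addn0.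
rewrite opprK addrACA addNr addr0 -wS -bw normS addrK.
by rewrite add0n.
Qed.

(** * The resolution of the constant module Z *)

(* [b] is the parity of the degree of the target, so that [d_even] goes from
   even to odd degree and is [d_step true]. *)
Definition step (b : bool) : M := if b then el w else el 1.

Definition d_step (b : bool) (y : M) :
    module_hom (rep ((y * step b)%g : obj (DM M))) (rep (y : obj (DM M))) :=
  if b return
    module_hom (rep ((y * step b)%g : obj (DM M))) (rep (y : obj (DM M)))
  then d_even y else d_odd y.

Lemma d_step_exact (b : bool) (y : M) : (b -> exists u, y = u * el 1)%g ->
  mh_exact (d_step (~~ b) (y * step b)%g) (d_step b y).
Proof.
case: b => /= [/(_ isT)[u ->]|_] z t; split.
- move=> t0; exists (s_even t); rewrite [RHS]homotopy_even t0.
  by rewrite (raddf0 (@s_odd (u * el 1)%g z)) addr0.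
- by move=> [s <-]; apply: d_even_odd.
- move=> t0; exists (s_odd t); rewrite [RHS]homotopy_odd t0.
  by rewrite (raddf0 (@s_even y z)) addr0.
- by move=> [s <-]; apply: d_odd_even.
Qed.

(** A graded piece of the multiplication map from A tensor A to A: every monomial goes to 1. *)
Definition cyclic_aug :
    module_hom (rep (1%g : obj (DM M))) (const_int (DM M)) :=
  rep_ext (A := const_int (DM M)) (1 : int).

Lemma cyclic_aug_gen z a b :
  el (a + b) = z -> mh cyclic_aug (gen 1%g z a b) = 1.
Proof.
move=> e; have [|f [-> _ _]] := @gen_arrow 1%g z a b; first by rewrite mul1g.
by rewrite rep_extE.
Qed.

Lemma cyclic_aug_surj : mh_surj cyclic_aug.
Proof.
move=> z n; exists (gen 1%g z (nat_of_ord z) 0 *~ n).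
rewrite mhMz cyclic_aug_gen; last by rewrite addn0; apply: (el_val z).
by rewrite intz.
Qed.

(** Again x^a y^b = (x^a y^b - x^(a+b)) + x^(a+b). Here x^(a+b) = x^z, the image of 1 under a
    section of the augmentation. *)
Lemma homotopy_aug z (t : rep (1%g : obj (DM M)) z) :
  t = mh (d_odd 1%g) (s_even t) +
      gen 1%g z (nat_of_ord z) 0 *~ (mh cyclic_aug t : int).
Proof.
pose k (n : int) := gen 1%g z (nat_of_ord z) 0 *~ n.
have kB : zmod_morphism k by move=> x y; rewrite /k mulrzBr.
pose K : {additive int -> rep (1%g : obj (DM M)) z} :=
  HB.pack k (GRing.isZmodMorphism.Build _ _ k kB).
apply: (gen_ext (g := idfun) (h := (@mh _ _ _ (d_odd 1%g) z \o @s_even 1%g z) \+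
  (K \o @mh _ _ _ cyclic_aug z))) => a b ltb e.
change (gen 1%g z a b = mh (d_odd 1%g) (s_even (gen 1%g z a b)) +
  k (mh cyclic_aug (gen 1%g z a b))).
have ez : el (a + b) = z by rewrite -e mul1g.
rewrite cyclic_aug_gen // s_even_gen // mhN d_odd_norm; last first.
  by move=> b_gt0; rewrite -e mul_elD; congr (_ * el _)%g; lia.
rewrite opprB add0n /k mulr1z (@gen_congr _ _ (nat_of_ord z) 0 (a + b) 0) //.
  by rewrite subrK.
by rewrite ez; apply: (el_val z).
Qed.

Lemma cyclic_aug_exact : mh_exact (d_step false 1%g) cyclic_aug.
Proof.
move=> z t; split=> [t0|[s <-]].
  by exists (s_even t); rewrite [RHS]homotopy_aug t0 mulr0z addr0.
apply: (gen_ext (g := @mh _ _ _ cyclic_aug z \o @mh _ _ _ (d_odd 1%g) z)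
  (h := \0)) => a b _ e.
change (mh cyclic_aug (mh (d_odd 1%g) (gen (1 * el 1)%g z a b)) = 0).
rewrite d_odd_gen // mhB !cyclic_aug_gen ?subrr // -e mul1g elD; congr el; lia.
Qed.

Fixpoint cyclic_obj n : M :=
  if n is k.+1 then (cyclic_obj k * step (odd k))%g else 1%g.

Lemma cyclic_exact n :
  mh_exact (d_step (odd n.+1) (cyclic_obj n.+1))
    (d_step (odd n) (cyclic_obj n)).
Proof.
(* An object in odd degree is its predecessor plus [el 1], as exactness at the source of [d_even]
   requires. *)
apply: d_step_exact; case: n => //= n odd_n; exists (cyclic_obj n).
by rewrite /step (negPf odd_n).
Qed.

Definition cyclic_resolution : resolution (const_int (DM M)) :=
  @Resolution (DM M) (const_int (DM M))
    (fun n => rep (cyclic_obj n : obj (DM M)))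
    (fun n => d_step (odd n) (cyclic_obj n)) cyclic_aug
    (fun n => rep_projective (y := cyclic_obj n : obj (DM M)))
    cyclic_aug_surj cyclic_aug_exact cyclic_exact.

(** * Periodicity of the resolution *)

Lemma cyclic_objE n : cyclic_obj n = el (n./2 * (m + q) + odd n).
Proof.
elim: n => [|n IHn]; first by rewrite el0.
rewrite -[LHS]/(cyclic_obj n * step (odd n))%g {}IHn /step.
rewrite /= uphalf_half mulnDl.
by case: (odd n); rewrite elD ?mul0n ?mul1n; congr el; lia.
Qed.

(** Write m = m' g and q = q' g with g the gcd. Then k' = k + 2 j q' has the parity of k, and the
    exponent grows by j q' (m + q) = j (m' + q') q, a multiple of q, which is invisible from m
    on. *)
Lemma cyclic_obj_period k k' :
  (m <= k./2 * (m + q) + odd k)%N -> (m <= k'./2 * (m + q) + odd k')%N ->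
  k = k' %[mod (2 * q) %/ gcdn m q] ->
  odd k = odd k' /\ cyclic_obj k = cyclic_obj k'.
Proof.
wlog lekk' : k k' / (k <= k')%N => [W mk mk' e|].
  by case/orP: (leq_total k k') => le; have [] := W _ _ le _ _ _.
set g := gcdn m q => mk mk' /eqP; rewrite eq_sym eqn_mod_dvd //.
have g_gt0 : (0 < g)%N by rewrite gcdn_gt0 q_gt0 orbT.
have /dvdnP[m' mE] : (g %| m)%N by apply: dvdn_gcdl.
have /dvdnP[q' qE] : (g %| q)%N by apply: dvdn_gcdr.
have -> : (2 * q %/ g = 2 * q')%N by rewrite qE mulnA mulnK.
move=> /dvdnP[j jE].
have k'E : k' = (k + (j * q').*2)%N by lia.
have oddE : odd k' = odd k by rewrite k'E oddD odd_double addbF.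
split; first by rewrite oddE.
rewrite !cyclic_objE oddE -(el_period (j * (m' + q')) mk); congr el.
have -> : k'./2 = (k./2 + j * q')%N.
  by rewrite k'E halfD odd_double andbF doubleK.
have -> : (j * (m' + q') * q = j * q' * (m + q))%N.
  by rewrite {1}qE {1}mE {1}qE; lia.
lia.
Qed.

(** Both differentials around degree k + 1 are functions of the parity of k and of [cyclic_obj k]
    alone, so the groups are equal, not merely isomorphic. *)
Lemma Ext_of_cyclic_period (A : module (DM M)) k k' :
  odd k = odd k' -> cyclic_obj k = cyclic_obj k' ->
  Ext_of cyclic_resolution k.+1 A = Ext_of cyclic_resolution k'.+1 A.
Proof.
pose F b (y : M) := homology (precomp A (d_step b y))
  (precomp A (d_step (~~ b) (y * step b)%g)).
by move=> o e; change (F (odd k) (cyclic_obj k) = F (odd k') (cyclic_obj k'));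
  rewrite o e.
Qed.

Lemma Tor_of_cyclic_period (B : module (op (DM M))) k k' :
  odd k = odd k' -> cyclic_obj k = cyclic_obj k' ->
  Tor_of cyclic_resolution k.+1 B = Tor_of cyclic_resolution k'.+1 B.
Proof.
pose F b (y : M) := homology (tensor_map B (d_step (~~ b) (y * step b)%g))
  (tensor_map B (d_step b y)).
by move=> o e; change (F (odd k) (cyclic_obj k) = F (odd k') (cyclic_obj k'));
  rewrite o e.
Qed.

Lemma leech_cyclic_period k k' :
  (m <= k./2 * (m + q) + odd k)%N -> (m <= k'./2 * (m + q) + odd k')%N ->
  k.+1 = k'.+1 %[mod (2 * q) %/ gcdn m q] ->
  (forall A : module (DM M),
     zmod_iso (leech_cohomology k.+1 A) (leech_cohomology k'.+1 A)) /\
  (forall B : module (op (DM M)),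
     zmod_iso (leech_homology k.+1 B) (leech_homology k'.+1 B)).
Proof.
move=> mk mk' ekk'.
have {}ekk' : k = k' %[mod (2 * q) %/ gcdn m q].
  by apply/eqP; rewrite -(eqn_modDr 1) !addn1 ekk'.
have [ok yk] := cyclic_obj_period mk mk' ekk'.
split=> [A|B].
  apply: (zmod_iso_trans (Ext_of_iso _ cyclic_resolution k A)).
  by rewrite (Ext_of_cyclic_period A ok yk); apply: Ext_of_iso.
apply: (zmod_iso_trans (Tor_of_iso _ cyclic_resolution k B)).
by rewrite (Tor_of_cyclic_period B ok yk); apply: Tor_of_iso.
Qed.

End Cyclic.

(* The two ranges of degrees *)
Local Close Scope ring_scope.

Theorem proposition5p3 (m q : nat) (q_gt0 : 0 < q) (mq_ge2 : 2 <= m + q) :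
  (forall p n : nat, 3 <= p -> 3 <= n ->
     p = n %[mod (2 * q) %/ gcdn m q] ->
     (forall A : module (DM (cyclic_monoid m q_gt0)),
        zmod_iso (leech_cohomology p A) (leech_cohomology n A)) /\
     (forall B : module (op (DM (cyclic_monoid m q_gt0))),
        zmod_iso (leech_homology p B) (leech_homology n B))) /\
  (m = 1 ->
   forall n : nat, 2 <= n -> n = 2 %[mod 2 * q] ->
     (forall A : module (DM (cyclic_monoid m q_gt0)),
        zmod_iso (leech_cohomology n A) (leech_cohomology 2 A)) /\
     (forall B : module (op (DM (cyclic_monoid m q_gt0))),
        zmod_iso (leech_homology n B) (leech_homology 2 B))).
Proof.
split=> [[|p] [|n] // p_ge3 n_ge3 epn | m1 [|n] // n_ge2 en].
  (* Here k is the degree minus one, so k is at least 2 and the exponent at least m + q. *)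
  have le_deg k : 1 < k -> m <= k./2 * (m + q) + odd k.
    by case: k => [|[|k]] // _; rewrite /= mulSn -!addnA leq_addr.
  by apply: leech_cyclic_period => //; apply: le_deg.
(* For m = 1, k = 1 is also allowed, since its exponent 1 equals m; this admits degree 2. *)
have le_deg k : 0 < k -> m <= k./2 * (m + q) + odd k.
  by case: k => [|[|k]] // _; rewrite /= ?m1 // mulSn -!addnA leq_addr.
apply: leech_cyclic_period; rewrite ?le_deg //.
by rewrite m1 gcd1n divn1.
Qed.
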